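(* Let $A$ be a simple two-sided skew brace. Then one of the following holds: (1) $A\cong \mathrm{Triv}(G)$ for a simple group $G$; (2) $A\cong \mathrm{opTriv}(G)$ for a simple group $G$; (3) $A$ is a simple two-sided brace.
   Context: A skew (left) brace is a triple $(A,+,\circ)$ such that $(A,+)$ and $(A,\circ)$ are (not necessarily abelian) groups and $a\circ(b+c)=a\circ b-a+a\circ c$ for all $a,b,c\in A$. The two groups share the same identity element, denoted $0$. It is two-sided if moreover $(a+b)\circ c=a\circ c-c+b\circ c$ for all $a,b,c\in A$. A brace is a skew brace whose additive group is abelian; a two-sided brace is a brace that is two-sided. Isomorphisms of skew braces are bijections preserving both operations. An ideal of $A$ is a subset $I$ that is a normal subgroup of both $(A,+)$ and $(A,\circ)$ and satisfies $-a+a\circ x\in I$ for all $a\in A$, $x\in I$. A skew brace $A$ is simple if its only ideals are $\{0\}$ and $A$. Likewise, a group is called simple here if its only normal subgroups are the trivial subgroup and the whole group (the one-element case is not excluded). For a group $G$, the trivial skew brace $\mathrm{Triv}(G)$ is the set $G$ with $g+h=g\circ h=gh$, and the almost trivial skew brace $\mathrm{opTriv}(G)$ is the set $G$ with $g+h=hg$ and $g\circ h=gh$ (i.e. the additive group of $\mathrm{Triv}(G)$ is replaced by its opposite group). *)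

(* Defs.v *)
From HB Require Import structures.
From mathcomp Require Import all_boot.
From mathcomp Require Import boolp classical_sets.

Set Implicit Arguments.
Unset Strict Implicit.
Unset Printing Implicit Defensive.

Local Open Scope classical_set_scope.

(* The group structure inherited from [groupType] is the circle group (A, ∘).
   The additive group, which need not be commutative, has its own operations;
   that its identity is that of (A, ∘) is a consequence of the axioms. *)
HB.mixin Record isSkewBrace A of Group A := {
  sbadd : A -> A -> A;
  sbzero : A;
  sbopp : A -> A;
  sbaddA : associative sbadd;
  sbadd0l : left_id sbzero sbadd;
  sbadd0r : right_id sbzero sbadd;
  sbaddNl : left_inverse sbzero sbopp sbadd;
  sbaddNr : right_inverse sbzero sbopp sbadd;
  sbmulDr : forall a b c : A,
    (a * sbadd b c)%g = sbadd (sbadd (a * b)%g (sbopp a)) (a * c)%g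
}.

#[short(type="skewBraceType")]
HB.structure Definition SkewBrace := {A of isSkewBrace A & Group A}.

Declare Scope sbrace_scope.
Delimit Scope sbrace_scope with B.
Notation "0" := sbzero : sbrace_scope.
Notation "a + b" := (sbadd a b) : sbrace_scope.
Notation "- a" := (sbopp a) : sbrace_scope.
Notation "a - b" := (sbadd a (sbopp b)) : sbrace_scope.
Notation "a ∘ b" := (a * b)%g (at level 40, left associativity) : sbrace_scope.

Local Open Scope sbrace_scope.

(* The group (A, +), in the multiplicative notation of [groupType]. *)
Definition addgroup (A : Type) : Type := A.
HB.instance Definition _ (A : skewBraceType) := Choice.on (addgroup A).
HB.instance Definition _ (A : skewBraceType) :=
  isGroup.Build (addgroup A) (@sbaddA A) (@sbadd0l A) (@sbadd0r A)
    (@sbaddNl A) (@sbaddNr A).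

Definition normal_subgroup (G : groupType) (N : set G) : Prop :=
  [/\ N 1%g,
      forall x y, N x -> N y -> N (x * y)%g,
      forall x, N x -> N (x^-1)%g &
      forall x g, N x -> N (x ^ g)%g].

Definition simple_group (G : groupType) : Prop :=
  forall N : set G, normal_subgroup N -> N = [set 1%g] \/ N = setT.

Definition ideal (A : skewBraceType) (I : set A) : Prop :=
  [/\ @normal_subgroup (addgroup A) I,
      @normal_subgroup A I &
      forall a x : A, I x -> I (- a + a ∘ x)].

Definition simple_skew_brace (A : skewBraceType) : Prop :=
  forall I : set A, ideal I -> I = [set 0] \/ I = setT.

Definition two_sided (A : skewBraceType) : Prop :=
  forall a b c : A, (a + b) ∘ c = a ∘ c - c + b ∘ c.

Definition is_brace (A : skewBraceType) : Prop :=
  forall a b : A, a + b = b + a.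

Definition skew_brace_iso (A B : skewBraceType) : Prop :=
  exists f : A -> B,
    [/\ bijective f,
        forall x y, f (x + y) = f x + f y &
        forall x y, f (x ∘ y) = f x ∘ f y].

Definition Triv (G : Type) : Type := G.

Section Triv.
Variable G : groupType.

Fact triv_mulDr (a b c : G) : (a * (b * c) = a * b * a^-1 * (a * c))%g.
Proof. by rewrite -!mulgA mulKg. Qed.

HB.instance Definition _ := Group.on (Triv G).
HB.instance Definition _ :=
  isSkewBrace.Build (Triv G) (@mulgA G) (@mul1g G) (@mulg1 G)
    (@mulVg G) (@mulgV G) triv_mulDr.

End Triv.

Definition opTriv (G : Type) : Type := G.

Section OpTriv.
Variable G : groupType.

Definition opmul (g h : G) : G := (h * g)%g.

Fact opmulA : associative opmul.
Proof. by move=> a b c; rewrite /opmul mulgA. Qed.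

Fact opTriv_mulDr (a b c : G) :
  (a * opmul b c)%g = opmul (opmul (a * b)%g a^-1%g) (a * c)%g.
Proof. by rewrite /opmul mulKg mulgA. Qed.

HB.instance Definition _ := Group.on (opTriv G).
HB.instance Definition _ :=
  isSkewBrace.Build (opTriv G) opmulA (@mulg1 G) (@mul1g G)
    (@mulgV G) (@mulVg G) opTriv_mulDr.

End OpTriv.

(* Main.v *)
Require Import Defs.
From HB Require Import structures.
From mathcomp Require Import all_boot.
From mathcomp Require Import classical_sets.

(** Write [a * b = - a + a ∘ b - b].  The additive subgroup [A^2] spanned by the
    elements [a * b] is an ideal, and so is its analogue [A_op^2] for the
    opposite addition.  Expanding [(a + b) ∘ (c + d)] by left and by right
    distributivity in either order shows that [A^2] and [A_op^2] centralise each
    other in [(A, +)].  If [A] is simple, then either [A^2 = 0] and [A] is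
    trivial, or [A_op^2 = 0] and [A] is almost trivial, or both are [A], whose
    additive group is therefore abelian. *)

Local Open Scope classical_set_scope.
Local Open Scope sbrace_scope.

Lemma sbaddKl (A : skewBraceType) (a b : A) : - a + (a + b) = b.
Proof. exact: (@mulKg (addgroup A)). Qed.

Lemma sbaddNKl (A : skewBraceType) (a b : A) : a + (- a + b) = b.
Proof. exact: (@mulVKg (addgroup A)). Qed.

Lemma sbaddK (A : skewBraceType) (a b : A) : a + b - b = a.
Proof. exact: (@mulgK (addgroup A)). Qed.

Lemma sbaddNK (A : skewBraceType) (a b : A) : a - b + b = a.
Proof. exact: (@mulgVK (addgroup A)). Qed.

Lemma sbaddI (A : skewBraceType) (a : A) : injective (sbadd a).
Proof. exact: (@mulgI (addgroup A)). Qed.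

Lemma sbaddIr (A : skewBraceType) (a : A) : injective (fun x => x + a).
Proof. exact: (@mulIg (addgroup A)). Qed.

Lemma sboppK (A : skewBraceType) (a : A) : - - a = a.
Proof. exact: (@invgK (addgroup A)). Qed.

Lemma sboppD (A : skewBraceType) (a b : A) : - (a + b) = - b - a.
Proof. exact: (@invgM (addgroup A)). Qed.

Lemma sbopp0 (A : skewBraceType) : - 0 = 0 :> A.
Proof. exact: (@invg1 (addgroup A)). Qed.

Lemma sbsub_eq0 (A : skewBraceType) (a b : A) : a - b = 0 -> a = b.
Proof. by move=> ab0; rewrite -[a](sbaddNK _ _ b) ab0 sbadd0l. Qed.

(** Left distributivity applied to [1 ∘ (0 + 0)] gives [0 = - 1]. *)
Lemma sbone (A : skewBraceType) : 1%g = 0 :> A.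
Proof.
have := sbmulDr (1%g : A) 0 0.
by rewrite !mul1g !sbadd0r !sbadd0l => /(congr1 sbopp); rewrite sboppK sbopp0.
Qed.

(** The usual lambda action of [(A, ∘)] on [(A, +)]; [lamD] and [lamM] are its additivity and
    multiplicativity. *)
Definition lam (A : skewBraceType) (a b : A) : A := - a + a ∘ b.

Definition star (A : skewBraceType) (a b : A) : A := lam A a b - b.

Lemma mul_lam (A : skewBraceType) (a b : A) : a ∘ b = a + lam A a b.
Proof. by rewrite /lam sbaddNKl. Qed.

Lemma lam_star (A : skewBraceType) (a b : A) : lam A a b = star A a b + b.
Proof. by rewrite /star sbaddNK. Qed.

Lemma lamD (A : skewBraceType) (a b c : A) :
  lam A a (b + c) = lam A a b + lam A a c.
Proof. by rewrite /lam sbmulDr !sbaddA. Qed.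

Lemma lam0 (A : skewBraceType) (a : A) : lam A a 0 = 0.
Proof. by rewrite /lam -sbone mulg1 sbaddNl sbone. Qed.

Lemma lamN (A : skewBraceType) (a b : A) : lam A a (- b) = - lam A a b.
Proof. by apply: (sbaddI _ (lam A a b)); rewrite -lamD !sbaddNr lam0. Qed.

Lemma lamM (A : skewBraceType) (a b c : A) :
  lam A (a ∘ b) c = lam A a (lam A b c).
Proof.
apply: (sbaddI _ (a ∘ b)); rewrite -mul_lam -mulgA (mul_lam _ b).
by rewrite !(mul_lam _ a) (lamD _ a b) sbaddA.
Qed.

Inductive add_span (A : skewBraceType) (S : A -> Prop) : A -> Prop :=
| add_span_gen x : S x -> add_span A S x
| add_span0 : add_span A S 0
| add_spanD x y : add_span A S x -> add_span A S y -> add_span A S (x + y)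
| add_spanN x : add_span A S x -> add_span A S (- x).

Lemma add_span_commute (A : skewBraceType) (S T : A -> Prop) :
  (forall x y, S x -> T y -> x + y = y + x) ->
  forall x y, add_span A S x -> add_span A T y -> x + y = y + x.
Proof.
(* The centraliser of [x] is an additive subgroup; this is used once in each argument. *)
have ext (P : A -> Prop) x : (forall y, P y -> x + y = y + x) ->
    forall y, add_span A P y -> x + y = y + x.
  move=> comm y; elim=> {y} [y | | y z _ xy _ xz | y _ xy].
  - exact: comm.
  - by rewrite sbadd0l sbadd0r.
  - by rewrite sbaddA xy -sbaddA xz sbaddA.
  - by apply: (sbaddI _ y); rewrite sbaddA -xy sbaddK sbaddNKl.
move=> comm x y Sx Ty; apply/esym; apply: (ext _ _ _ _ Sx) => z Sz; apply/esym.
by apply: (ext _ _ _ _ Ty) => t; apply: comm.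
Qed.

Definition square (A : skewBraceType) : set A :=
  add_span A (fun x => exists a b : A, x = star A a b).

Lemma square_star (A : skewBraceType) (a b : A) : square A (star A a b).
Proof. by apply: add_span_gen; exists a, b. Qed.

Lemma square_lam (A : skewBraceType) (a x : A) :
  square A x -> square A (lam A a x).
Proof.
elim=> {x} [_ [b [c ->]] | | x y _ IHx _ IHy | x _ IHx].
(* Insert [- c + c] between [lam A (a ∘ b) c] and [- lam A a c]. *)
- have -> : lam A a (star A b c) = star A (a ∘ b) c - star A a c.
    by rewrite /star lamD lamN -lamM sboppD sboppK sbaddA sbaddNK.
  by apply: add_spanD; [|apply: add_spanN]; apply: square_star.
- by rewrite lam0; apply: add_span0.
- by rewrite lamD; apply: add_spanD.
- by rewrite lamN; apply: add_spanN.
Qed.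

Lemma square_conj (A : skewBraceType) (a x : A) :
  square A x -> square A (a + x - a).
Proof.
elim=> {x} [_ [b [c ->]] | | x y _ IHx _ IHy | x _ IHx].
(* Additivity of [lam A b] gives [star A b (a + c) = star A b a + (a + star A b c - a)]. *)
- have -> : a + star A b c - a = - star A b a + star A b (a + c).
    by rewrite /star lamD !sboppD sboppK !sbaddA !sbaddNK.
  by apply: add_spanD; [apply: add_spanN|]; apply: square_star.
- by rewrite sbadd0r sbaddNr; apply: add_span0.
- have -> : a + (x + y) - a = (a + x - a) + (a + y - a).
    by rewrite !sbaddA sbaddNK.
  exact: add_spanD.
- have -> : a - x - a = - (a + x - a) by rewrite !sboppD sboppK sbaddA.
  exact: add_spanN.
Qed.

Lemma square_ideal (A : skewBraceType) : two_sided A -> ideal (square A).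
Proof.
move=> A2; split; last by move=> a x; apply: square_lam.
- split; [exact: add_span0 | exact: add_spanD | exact: add_spanN | move=> x g Ix].
  have := square_conj A (- g) x Ix; rewrite sboppK -sbaddA; exact.
split=> [|x y Ix Iy|x Ix|x g Ix].
- by rewrite sbone; apply: add_span0.
- by rewrite mul_lam; apply: add_spanD => //; apply: square_lam.
- have -> : (x^-1)%g = - lam A (x^-1)%g x.
    by rewrite /lam mulVg sbone sbadd0r sboppK.
  by apply/add_spanN/square_lam.
(* Write [g^-1 ∘ x] as [y + g^-1] with [y] an additive conjugate of [lam A g^-1 x]; right
   distributivity then turns [(y + g^-1) ∘ g] into [y ∘ g - g]. *)
- rewrite conjgE mulgA (mul_lam _ _ x) -[_ + lam _ _ _](sbaddNK _ _ (g^-1)%g).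
  have := square_conj A (g^-1)%g _ (square_lam A (g^-1)%g x Ix).
  set y := _ - _ => Iy.
  have -> : (y + g^-1%g) ∘ g = y + star A y g.
    by rewrite A2 mulVg sbone sbadd0r mul_lam lam_star sbaddA sbaddK.
  by apply: add_spanD => //; apply: square_star.
Qed.

Lemma square_eq0 (A : skewBraceType) :
  square A = [set 0] -> forall a b : A, a ∘ b = a + b.
Proof.
move=> A0 a b; rewrite mul_lam; congr (_ + _); apply: sbsub_eq0.
by have := square_star A a b; rewrite A0.
Qed.

(** An alias carrying the opposite skew brace, with the same circle group. [A_op^2] is
    [square (opbrace A)], so the results on [square] apply to it. *)
Definition opbrace (A : Type) : Type := A.

Definition opadd (A : skewBraceType) (a b : A) : A := b + a.

Fact opaddA (A : skewBraceType) : associative (opadd A).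
Proof. by move=> a b c; rewrite /opadd sbaddA. Qed.

Fact opbrace_mulDr (A : skewBraceType) (a b c : A) :
  a ∘ opadd A b c = opadd A (opadd A (a ∘ b) (- a)) (a ∘ c).
Proof. by rewrite /opadd sbmulDr sbaddA. Qed.

HB.instance Definition _ (A : skewBraceType) := Group.on (opbrace A).
HB.instance Definition _ (A : skewBraceType) :=
  isSkewBrace.Build (opbrace A) (opaddA A) (@sbadd0r A) (@sbadd0l A)
    (@sbaddNr A) (@sbaddNl A) (opbrace_mulDr A).

Lemma opbrace_two_sided (A : skewBraceType) :
  two_sided A -> two_sided (opbrace A).
Proof.
move=> A2 a b c; have := A2 b a c; rewrite -sbaddA; exact.
Qed.

Lemma opbrace_ideal (A : skewBraceType) (I : set A) :
  @ideal (opbrace A) I -> @ideal A I.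
Proof.
case=> -[I0 ID IN IJ] IM Ilam.
have IC (x g : A) : I x -> I (- g + x + g).
  move=> Ix; have : I (- g + x - - g) := IJ x (- g) Ix.
  by rewrite sboppK.
split=> //; last first.
  (* The opposite lambda condition provides [a ∘ x - a], an additive conjugate of [- a + a ∘ x]. *)
  move=> a x Ix; have : I (- a + (a ∘ x - a) + a) := IC _ a (Ilam a x Ix).
  by rewrite sbaddA sbaddNK.
split=> // [x y Ix Iy | x g Ix]; first exact: ID.
have := IC x g Ix; rewrite -sbaddA; exact.
Qed.

Lemma opbrace_add_span (A : skewBraceType) (S : A -> Prop) (x : A) :
  add_span (opbrace A) S x -> add_span A S x.
Proof.
elim=> {x} [x | | x y _ Sx _ Sy | x _ Sx].
- exact: add_span_gen.
- exact: add_span0.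
- exact: add_spanD Sy Sx.
- exact: add_spanN Sx.
Qed.

(* The element [- c + (b ∘ c - b)] is [star (opbrace A) b c]. *)
Lemma star_opstar_commute (A : skewBraceType) (a b c d : A) :
  two_sided A ->
  star A a d + (- c + (b ∘ c - b)) = - c + (b ∘ c - b) + star A a d.
Proof.
move=> A2.
have : (a + b) ∘ c - (a + b) + (a + b) ∘ d =
       a ∘ (c + d) - (c + d) + b ∘ (c + d) by rewrite -A2 sbmulDr.
(* Both expansions start with [a ∘ c] and end with [b ∘ d]; cancelling these leaves the
   commutation. *)
rewrite !A2 !sbmulDr !sboppD !sbaddA => /sbaddIr.
rewrite -!sbaddA => /sbaddI; rewrite /star /lam !sbaddA => <-.
by [].
Qed.

(** In the trivial and almost trivial cases alike, [G] is the circle group of [A]. *)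
Lemma simple_circle_group (A : skewBraceType) :
  (forall N : set A, @normal_subgroup A N -> ideal N) ->
  simple_skew_brace A -> simple_group A.
Proof. by move=> NI As N /NI /As; rewrite sbone. Qed.

(** Inverses and conjugations agree along with the operations, and [- a + a ∘ x] reduces to [x]. *)
Lemma trivial_normal_ideal (A : skewBraceType) (N : set A) :
  (forall a b : A, a ∘ b = a + b) -> @normal_subgroup A N -> ideal N.
Proof.
move=> AT [N1 NM NV NJ].
have NE (x : A) : - x = (x^-1)%g.
  by apply: (sbaddI _ x); rewrite -(AT x (x^-1)%g) sbaddNr mulgV sbone.
split=> // [|a x Nx]; last by rewrite AT sbaddKl.
split=> [|x y Nx Ny|x Nx|x g Nx].
- by have := N1; rewrite sbone.
- by have := NM x y Nx Ny; rewrite AT.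
- by have := NV x Nx; rewrite -NE.
- by have := NJ x g Nx; rewrite conjgE !AT -NE.
Qed.

Theorem theorem4p7 (A : skewBraceType)
    (A_simple : simple_skew_brace A) (A_two_sided : two_sided A) :
  (exists G : groupType, simple_group G /\ skew_brace_iso A (Triv G)) \/
  (exists G : groupType, simple_group G /\ skew_brace_iso A (opTriv G)) \/
  (simple_skew_brace A /\ two_sided A /\ is_brace A).
Proof.
have idbij : bijective (id : A -> A) by exists id.
have [A0|AT] := A_simple _ (square_ideal A A_two_sided).
  have AM := square_eq0 A A0.
  left; exists A; split.
    by apply: simple_circle_group => // N; apply: trivial_normal_ideal.
  by exists id; split=> // x y; rewrite -AM.
have opI := square_ideal (opbrace A) (opbrace_two_sided A A_two_sided).
have [B0|BT] := A_simple _ (opbrace_ideal A _ opI).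
  have BM : forall a b : A, a ∘ b = b + a := square_eq0 (opbrace A) B0.
  right; left; exists A; split.
    (* By [BM] the opposite brace is trivial, so [N] is an ideal of it, hence of [A]. *)
    apply: simple_circle_group => // N.
    by move=> /(trivial_normal_ideal (opbrace A) N BM) /opbrace_ideal.
  by exists id; split=> // x y; rewrite -BM.
right; right; split=> //; split=> // x y.
have Ax : square A x by rewrite AT.
have By : square (opbrace A) y by rewrite BT.
apply: (add_span_commute A _ _ _ x y Ax (opbrace_add_span A _ y By)).
by move=> _ _ [a [d ->]] [b [c ->]]; apply: star_opstar_commute.
Qed.
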